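(* Let $\mathcal{S}=[v^1,\dots,v^{\bar p+1}]$ (the simplex with vertices $v^1,\dots,v^{\bar p+1}\in\mathbb{R}^{\bar p}$) be $\mathcal{S}^0$ or any sub-simplex of $\mathcal{S}^0$. Then the problem $$LB(\mathcal{S})=\min_{w\in\triangle_{\bar p}}\ \sum_{i=1}^{\bar p+1}\Bigl(\psi(v^i)+\sum_{j=1}^{\bar p}\alpha_j\ln v^i_j\Bigr)w_i-\sum_{j=1}^{\bar p}\alpha_j\ln\Bigl(\sum_{i=1}^{\bar p+1}v^i_jw_i\Bigr)$$ is a convex program whose optimal value is a lower bound for the problem $\min_{t\in\mathcal{S}}\psi(t)$, i.e. $LB(\mathcal{S})\le\min_{t\in\mathcal{S}}\psi(t)$.
   Context: Setting. $p\ge 2$, $A\in\mathbb{R}^{m\times n}$, $b\in\mathbb{R}^m$, $\mathcal{X}=\{x\in\mathbb{R}^n : Ax\le b\}$ is nonempty, bounded and $n$-dimensional; $c_j\in\mathbb{R}^n$, $d_j\in\mathbb{R}$, $\alpha_j\in\mathbb{R}\setminus\{0\}$ and $\min_{x\in\mathcal{X}}(c_j^\top x+d_j)>0$ for $j=1,\dots,p$. The indices are ordered so that $\alpha_j>0$ for $j\in J^+=\{1,\dots,\bar p\}$ and $\alpha_j<0$ for $j\in J^-=\{\bar p+1,\dots,p\}$, where $1\le\bar p\le p$. For $j\in J^+$ let $$\underline t_j=\frac{1}{\max_{x\in\mathcal{X}}(c_j^\top x+d_j)}>0,\qquad \overline t_j=\frac{1}{\min_{x\in\mathcal{X}}(c_j^\top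 x+d_j)}.$$ Let $\mathcal{S}^0\subset\mathbb{R}^{\bar p}$ be the simplex (convex hull) with vertices $v^{0,1}=(\underline t_1,\dots,\underline t_{\bar p})^\top$ and $v^{0,j+1}=v^{0,1}+\bar p(\overline t_j-\underline t_j)e_j$, $j=1,\dots,\bar p$, where $e_j$ is the $j$-th standard basis vector. A sub-simplex of $\mathcal{S}^0$ is a simplex with $\bar p+1$ vertices contained in $\mathcal{S}^0$. For $x\in\mathcal{X}$ and $t\in\mathcal{S}^0$ let $$\phi(x,t)=\sum_{j\in J^-}\alpha_j\ln(c_j^\top x+d_j)+\sum_{j\in J^+}\alpha_j\bigl(t_j(c_j^\top x+d_j)-\ln t_j-1\bigr),\qquad \psi(t)=\min_{x\in\mathcal{X}}\phi(x,t).$$ $\triangle_{\bar p}=\{w\in\mathbb{R}^{\bar p+1}:\sum_{i=1}^{\bar p+1}w_i=1,\ w_i\ge 0,\ i=1,\dots,\bar p+1\}$; $v^i_j$ is the $j$-th coordinate of $v^i$. *)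

(* Defs.v *)
From HB Require Import structures.
From mathcomp Require Import all_boot all_order all_algebra.
From mathcomp Require Import all_classical all_reals all_analysis.

Set Implicit Arguments.
Unset Strict Implicit.
Unset Printing Implicit Defensive.

Import Order.TTheory GRing.Theory Num.Theory numFieldNormedType.Exports.
Local Open Scope classical_set_scope.
Local Open Scope ring_scope.

(* [minval D f] and [maxval D f] are total operators; they are the minimum and
   the maximum of [f] over [D] whenever those exist ([has_minimum]). *)
Definition minval (R : realType) (T : Type) (D : set T) (f : T -> R) : R :=
  inf (f @` D).

Definition maxval (R : realType) (T : Type) (D : set T) (f : T -> R) : R :=
  sup (f @` D).

Definition has_minimum (R : realType) (T : Type) (D : set T) (f : T -> R) :
    Prop :=
  exists2 x, D x & forall y, D y -> f x <= f y.

(* Minimization of [f] over [D], with [D] and [f] convex. *)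
Definition convex_program (R : realType) (E : lmodType R) (D : set E)
    (f : E -> R) : Prop :=
  convex_set D /\ convex_function D f.

Definition affinely_independent (R : realType) (n k : nat)
    (v : 'I_k -> 'cV[R]_n) : Prop :=
  forall a : 'I_k -> R,
    \sum_i a i = 0 -> \sum_i a i *: v i = 0 -> forall i, a i = 0.

(* A subset of R^n has dimension n iff it contains n + 1 affinely independent
   points (n + 2 points of R^n are never affinely independent). *)
Definition full_dimensional (R : realType) (n : nat) (X : set 'cV[R]_n) :
    Prop :=
  exists v : 'I_n.+1 -> 'cV[R]_n,
    affinely_independent v /\ forall i, X (v i).

Definition std_simplex (R : realType) (k : nat) : set 'cV[R]_k.+1 :=
  [set w | \sum_i w i 0 = 1 /\ forall i, 0 <= w i 0].
Arguments std_simplex R k : clear implicits.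

Definition simplex (R : realType) (n k : nat) (v : 'I_k.+1 -> 'cV[R]_n) :
    set 'cV[R]_n :=
  [set \sum_i w i 0 *: v i | w in std_simplex R k].

Definition polyhedron (R : realType) (m n : nat) (A : 'M[R]_(m, n))
    (b : 'cV[R]_m) : set 'cV[R]_n :=
  [set x | forall i, (A *m x) i 0 <= b i 0].

Definition affine_form (R : realType) (n p : nat) (c : 'I_p -> 'cV[R]_n)
    (d : 'I_p -> R) (j : 'I_p) (x : 'cV[R]_n) : R :=
  ((c j)^T *m x) 0 0 + d j.

(* Indices start at 0: J^+ consists of the [j : 'I_p] with [j < pbar], embedded
   from ['I_pbar] by [widen_ord hp], and J^- of those with [pbar <= j]. *)
Definition tlow (R : realType) (n p pbar : nat) (hp : (pbar <= p)%N)
    (X : set 'cV[R]_n) (c : 'I_p -> 'cV[R]_n) (d : 'I_p -> R) : 'cV[R]_pbar :=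
  \col_j (maxval X (affine_form c d (widen_ord hp j)))^-1.

Definition thigh (R : realType) (n p pbar : nat) (hp : (pbar <= p)%N)
    (X : set 'cV[R]_n) (c : 'I_p -> 'cV[R]_n) (d : 'I_p -> R) : 'cV[R]_pbar :=
  \col_j (minval X (affine_form c d (widen_ord hp j)))^-1.

(* Vertex 0 is [tlow]; vertex j + 1 is shifted from it along axis j. *)
Definition vertex0 (R : realType) (n p pbar : nat) (hp : (pbar <= p)%N)
    (X : set 'cV[R]_n) (c : 'I_p -> 'cV[R]_n) (d : 'I_p -> R)
    (i : 'I_pbar.+1) : 'cV[R]_pbar :=
  let tl := tlow hp X c d in
  let th := thigh hp X c d in
  if unlift ord0 i is Some j
  then tl + (pbar%:R * (th j 0 - tl j 0)) *: delta_mx j 0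
  else tl.

Definition simplex0 (R : realType) (n p pbar : nat) (hp : (pbar <= p)%N)
    (X : set 'cV[R]_n) (c : 'I_p -> 'cV[R]_n) (d : 'I_p -> R) :
    set 'cV[R]_pbar :=
  simplex (vertex0 hp X c d).

Definition phi (R : realType) (n p pbar : nat) (hp : (pbar <= p)%N)
    (c : 'I_p -> 'cV[R]_n) (d alpha : 'I_p -> R)
    (x : 'cV[R]_n) (t : 'cV[R]_pbar) : R :=
  \sum_(j < p | (pbar <= j)%N) alpha j * ln (affine_form c d j x) +
  \sum_(j < pbar) alpha (widen_ord hp j) *
    (t j 0 * affine_form c d (widen_ord hp j) x - ln (t j 0) - 1).

Definition psi (R : realType) (n p pbar : nat) (hp : (pbar <= p)%N)
    (X : set 'cV[R]_n) (c : 'I_p -> 'cV[R]_n) (d alpha : 'I_p -> R)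
    (t : 'cV[R]_pbar) : R :=
  minval X (fun x => phi hp c d alpha x t).

Definition LB_objective (R : realType) (n p pbar : nat) (hp : (pbar <= p)%N)
    (X : set 'cV[R]_n) (c : 'I_p -> 'cV[R]_n) (d alpha : 'I_p -> R)
    (v : 'I_pbar.+1 -> 'cV[R]_pbar) (w : 'cV[R]_pbar.+1) : R :=
  \sum_(i < pbar.+1)
    (psi hp X c d alpha (v i) +
     \sum_(j < pbar) alpha (widen_ord hp j) * ln (v i j 0)) * w i 0 -
  \sum_(j < pbar) alpha (widen_ord hp j) *
    ln (\sum_(i < pbar.+1) v i j 0 * w i 0).

Definition LB (R : realType) (n p pbar : nat) (hp : (pbar <= p)%N)
    (X : set 'cV[R]_n) (c : 'I_p -> 'cV[R]_n) (d alpha : 'I_p -> R)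
    (v : 'I_pbar.+1 -> 'cV[R]_pbar) : R :=
  minval (std_simplex R pbar) (LB_objective hp X c d alpha v).

(* Main.v *)
(* For fixed x, the function phi(x, t) + sum_(j in J+) alpha_j ln t_j is affine
   in t, so psi(t) + sum_j alpha_j ln t_j, a minimum of affine functions, is
   concave and dominates its linear interpolation between the vertices v^i.
   Subtracting sum_j alpha_j ln t_j at t = sum_i w_i v^i gives the objective of
   LB; it is convex because ln is concave and alpha_j > 0 on J+. *)

Require Import Defs.
From HB Require Import structures.
From mathcomp Require Import all_boot all_order all_algebra.
From mathcomp Require Import all_classical all_reals all_analysis.
From mathcomp Require Import ring lra.

Import Order.TTheory GRing.Theory Num.Theory numFieldNormedType.Exports.
Local Open Scope classical_set_scope.
Local Open Scope ring_scope.

Lemma continuous_sum_at (R : realType) (T : topologicalType) (I : Type)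
    (r : seq I) (P : pred I) (F : I -> T -> R) (x : T) :
  (forall i, P i -> {for x, continuous (F i)}) ->
  {for x, continuous (fun y => \sum_(i <- r | P i) F i y)}.
Proof.
move=> Fc; apply: (@cvg_big R I +%R 0 P _ T (nbhs x) r F (F^~ x)) => //.
exact: add_continuous.
Qed.

Lemma mulmx_coord_continuous_at (R : realType) (m n : nat) (A : 'M[R]_(m, n))
    (T : topologicalType) (g : T -> 'cV[R]_n) (i : 'I_m) (x : T) :
  (forall k, {for x, continuous (fun y => g y k 0)}) ->
  {for x, continuous (fun y => (A *m g y) i 0)}.
Proof.
move=> gc; under [X in {for x, continuous X}]eq_fun do rewrite mxE.
apply: continuous_sum_at => k _; apply: cvgM; [exact: cvg_cst|exact: gc].
Qed.

Lemma trmx_continuous (R : realType) (m n : nat) :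
  continuous (@trmx R m n).
Proof.
move=> x; apply/(@cvg_ballP _ _ _ (nbhs x) (nbhs_filter x)) => e e0.
near=> y; split=> // i j; rewrite !mxE.
have [_] : ball x e y by near: y; exact: nbhsx_ballx.
exact.
Unshelve. all: by end_near. Qed.

Lemma bounded_closed_compact_cV (R : realType) (n : nat) (A : set 'cV[R]_n) :
  bounded_set A -> closed A -> compact A.
Proof.
move=> [M [Mreal ltM]] clA.
have -> : A = trmx @` (@trmx R 1 n @^-1` A).
  apply/seteqP; split => [x Ax|_ [y Ay <-] //].
  by exists x^T; rewrite /preimage/= trmxK.
apply: continuous_compact.
  exact/continuous_subspaceT/trmx_continuous.
apply: bounded_closed_compact; last first.
  by move/continuous_closedP: (@trmx_continuous R 1 n); exact.
exists (M + 2); split; first by rewrite num_real.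
move=> N ltN x Ax; apply/ltW.
have [N0 xN] : ball (0 : 'cV[R]_n) N x^T.
  rewrite mx_norm_ball /ball_/= sub0r normrN.
  by apply: le_lt_trans (ltM (M + 1) _ _ Ax) _; lra.

have : ball (0 : 'rV[R]_n) N x.
  by split=> // i j; have := xN j i; rewrite !mxE.
by rewrite mx_norm_ball /ball_/= sub0r normrN.
Qed.

Lemma polyhedron_compact (R : realType) (m n : nat) (A : 'M[R]_(m, n))
    (b : 'cV[R]_m) : bounded_set (polyhedron A b) -> compact (polyhedron A b).
Proof.
move=> /bounded_closed_compact_cV; apply.
have -> : polyhedron A b =
    \bigcap_i ((fun x => (A *m x) i 0) @^-1` [set y | y <= b i 0]).
  by apply/seteqP; split => [x h i _|x h i]; [exact: h|exact: (h i I)].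
apply: closed_bigI => i _; apply: preimage_closed; last exact: closed_le.
move=> x _; apply: mulmx_coord_continuous_at => k.
exact: coord_continuous.
Qed.

Lemma std_simplex_compact (R : realType) (k : nat) :
  compact (std_simplex R k).
Proof.
apply: bounded_closed_compact_cV.
  exists 2; split; first by rewrite num_real.
  move=> N ltN w [w1 w0]; apply/ltW.
  suff : ball (0 : 'cV[R]_k.+1) N w.
    by rewrite mx_norm_ball /ball_/= sub0r normrN.
  split=> [|i j]; first lra.
  rewrite ord1 !mxE /ball/= sub0r normrN ger0_norm//.
  apply: (@le_lt_trans _ _ 1); last lra.
  by rewrite -w1 (bigD1 i)//= lerDl sumr_ge0.
have -> : std_simplex R k =
    (fun w : 'cV[R]_k.+1 => \sum_i w i 0) @^-1` [set y | y = 1] `&`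
    \bigcap_i ((fun w : 'cV[R]_k.+1 => w i 0) @^-1` [set y | 0 <= y]).
  apply/seteqP; split => [w [w1 w0]|w [w1 w0]]; split=> // i;
    last exact: (w0 i I).
  by move=> _; exact: w0.
apply: closedI.
  apply: preimage_closed; last exact: closed_eq.
  by move=> w _; apply: continuous_sum_at => i _; exact: coord_continuous.
apply: closed_bigI => i _; apply: preimage_closed; last exact: closed_ge.
by move=> w _; exact: coord_continuous.
Qed.

Lemma std_simplex_vertex (R : realType) (k : nat) (i : 'I_k.+1) :
  std_simplex R k (delta_mx i 0).
Proof.
split=> [|j]; last by rewrite mxE ler0n.
rewrite (bigD1 i)//= mxE !eqxx big1 ?addr0// => j /negPf ji.
by rewrite mxE ji.
Qed.

Lemma std_simplex_neq0 (R : realType) (k : nat) : std_simplex R k !=set0.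
Proof. by exists (delta_mx ord0 0); exact: std_simplex_vertex. Qed.

Lemma std_simplex_convex (R : realType) (k : nat) :
  convex_set (std_simplex R k).
Proof.
move=> x y l; rewrite !inE => -[x1 x0] [y1 y0]; split=> [|i].
  under eq_bigr do rewrite !mxE.
  by rewrite big_split/= -!mulr_sumr x1 y1 !mulr1 addrC subrK.
by rewrite !mxE addr_ge0// mulr_ge0// subr_ge0.
Qed.

Lemma simplex_vertex (R : realType) (n k : nat) (v : 'I_k.+1 -> 'cV[R]_n) i :
  simplex v (v i).
Proof.
exists (delta_mx i 0); first exact: std_simplex_vertex.
rewrite (bigD1 i)//= mxE !eqxx scale1r big1 ?addr0// => j /negPf ji.
by rewrite mxE ji scale0r.
Qed.

Lemma compact_has_minimum (R : realType) (T : topologicalType) (D : set T)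
    (f : T -> R) :
  D !=set0 -> compact D -> (forall x, D x -> {for x, continuous f}) ->
  has_minimum D f.
Proof.
move=> D0 cD fc.
have fD : {within D, continuous f}.
  by apply: continuous_in_subspaceT => x; rewrite inE; exact: fc.
have [x xD xmin] := compact_EVT_min D0 cD fD.
by exists x => [|y Dy]; [rewrite inE in xD|apply: xmin; rewrite inE].
Qed.

Lemma minval_le (R : realType) (T : Type) (D : set T) (f : T -> R) (x : T) :
  has_minimum D f -> D x -> minval D f <= f x.
Proof.
move=> [y Dy ymin] Dx; apply: ge_inf; last by exists x.
by exists (f y) => _ [z Dz <-]; exact: ymin.
Qed.

Lemma le_minval (R : realType) (T : Type) (D : set T) (f : T -> R) (a : R) :
  D !=set0 -> (forall x, D x -> a <= f x) -> a <= minval D f.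
Proof.
move=> [x Dx] af; apply: lb_le_inf; first by exists (f x); exists x.
by move=> _ [y Dy <-]; exact: af.
Qed.

Lemma le_maxval (R : realType) (T : Type) (D : set T) (f : T -> R) (x : T) :
  has_minimum D (fun y => - f y) -> D x -> f x <= maxval D f.
Proof.
move=> [y Dy ymin] Dx; apply: ub_le_sup; last by exists x.
by exists (f y) => _ [z Dz <-]; rewrite -lerN2; exact: ymin.
Qed.

Section LowerBound.
Variables (R : realType) (n p pbar : nat) (hp : (pbar <= p)%N).
Variables (X : set 'cV[R]_n) (c : 'I_p -> 'cV[R]_n) (d alpha : 'I_p -> R).
Hypothesis X0 : X !=set0.
Hypothesis cX : compact X.
Hypothesis alpha_pos : forall j : 'I_p, (j < pbar)%N -> 0 < alpha j.
Hypothesis form_pos : forall j, 0 < minval X (affine_form c d j).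

Let alphaw_ge0 (j : 'I_pbar) : 0 <= alpha (widen_ord hp j).
Proof. by apply/ltW/alpha_pos; rewrite /= ltn_ord. Qed.

Lemma affine_form_continuous_at (T : topologicalType) (g : T -> 'cV[R]_n) j
    (x : T) :
  (forall k, {for x, continuous (fun y => g y k 0)}) ->
  {for x, continuous (fun y => affine_form c d j (g y))}.
Proof.
move=> gc; apply: cvgD; last exact: cvg_cst.
exact: mulmx_coord_continuous_at.
Qed.

Lemma affine_form_gt0 j x : X x -> 0 < affine_form c d j x.
Proof.
move=> Xx; apply: lt_le_trans (form_pos j) _; apply: minval_le => //.
apply: compact_has_minimum => // y _.
by apply: affine_form_continuous_at => k; exact: coord_continuous.
Qed.

Lemma minval_le_maxval j :
  minval X (affine_form c d j) <= maxval X (affine_form c d j).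
Proof.
have fc y : {for y, continuous (affine_form c d j)}.
  by apply: affine_form_continuous_at => k; exact: coord_continuous.
have [x Xx] := X0.
apply: (@le_trans _ _ (affine_form c d j x)).
  by apply: minval_le => //; exact: compact_has_minimum.
apply: le_maxval => //; apply: compact_has_minimum => // y _.
by apply: continuousN; exact: fc.
Qed.

Lemma simplex0_gt0 t : simplex0 hp X c d t -> forall j, 0 < t j 0.
Proof.
move=> [w [w1 w0] <-] j.
have tlow_gt0 : 0 < tlow hp X c d j 0.
  by rewrite mxE invr_gt0; exact: lt_le_trans (minval_le_maxval _).
apply: lt_le_trans tlow_gt0 _; rewrite summxE.
rewrite -[leLHS]mul1r -w1 mulr_suml; apply: ler_sum => i _.
rewrite [leRHS]mxE ler_wpM2l// /vertex0; case: unlift => [k|//].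
rewrite [leRHS]mxE lerDl [leRHS]mxE mulr_ge0//; last by rewrite mxE ler0n.
rewrite mulr_ge0// subr_ge0 !mxE lef_pV2 ?minval_le_maxval// posrE//.
exact: lt_le_trans (minval_le_maxval _).
Qed.

Lemma phi_continuous_at (T : topologicalType) (g : T -> 'cV[R]_n)
    (h : T -> 'cV[R]_pbar) (x : T) :
  (forall k, {for x, continuous (fun y => g y k 0)}) ->
  (forall j, {for x, continuous (fun y => h y j 0)}) ->
  X (g x) -> (forall j, 0 < h x j 0) ->
  {for x, continuous (fun y => phi hp c d alpha (g y) (h y))}.
Proof.
move=> gc hc Xg h0; apply: cvgD; apply: continuous_sum_at => j _.
  apply: cvgM; first exact: cvg_cst.
  apply: (@continuous_comp _ _ _ (fun y => affine_form c d j (g y)) (@ln R)).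
    exact: affine_form_continuous_at.
  exact/continuous_ln/affine_form_gt0.
apply: cvgM; first exact: cvg_cst.
apply: cvgB; last exact: cvg_cst.
apply: cvgB.
  by apply: cvgM; [exact: hc|exact: affine_form_continuous_at].
by apply: (@continuous_comp _ _ _ (fun y => h y j 0) (@ln R));
  [exact: hc|exact: continuous_ln].
Qed.

Lemma phi_has_minimum (t : 'cV[R]_pbar) : (forall j, 0 < t j 0) ->
  has_minimum X (fun x => phi hp c d alpha x t).
Proof.
move=> t0; apply: compact_has_minimum => // x Xx.
apply: (@phi_continuous_at _ id (fun=> t)) => //.
  by move=> k; exact: coord_continuous.
by move=> j; exact: cst_continuous.
Qed.

Lemma psi_le_phi x (t : 'cV[R]_pbar) : X x -> (forall j, 0 < t j 0) ->
  psi hp X c d alpha t <= phi hp c d alpha x t.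
Proof.
move=> Xx /phi_has_minimum hm.
exact: (@minval_le _ _ _ (phi hp c d alpha ^~ t)).
Qed.

Section Simplex.
Variable v : 'I_pbar.+1 -> 'cV[R]_pbar.
Hypothesis v_gt0 : forall t, simplex v t -> forall j, 0 < t j 0.

Let comb (w : 'cV[R]_pbar.+1) : 'cV[R]_pbar := \sum_i w i 0 *: v i.

Let combE w j : comb w j 0 = \sum_i v i j 0 * w i 0.
Proof. by rewrite summxE; apply: eq_bigr => i _; rewrite mxE mulrC. Qed.

Let comb_gt0 w j : std_simplex R pbar w -> 0 < \sum_i v i j 0 * w i 0.
Proof. by move=> sw; rewrite -combE; apply: v_gt0; exists w. Qed.

Let comb_continuous j :
  continuous (fun w : 'cV[R]_pbar.+1 => \sum_i v i j 0 * w i 0).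
Proof.
move=> w; apply: continuous_sum_at => i _.
by apply: continuousM; [exact: cst_continuous|exact: coord_continuous].
Qed.

(* The minimum over [simplex v] is reached through a joint minimum of [phi] in
   [x] and in barycentric coordinates, which avoids continuity of [psi]. *)
Lemma psi_has_minimum : has_minimum (simplex v) (psi hp X c d alpha).
Proof.
have [x0 Xx0] := X0.
have [w0 sw0] := std_simplex_neq0 R pbar.
have [[x w] [/= Xx sw] xwmin] : has_minimum (X `*` std_simplex R pbar)
    (fun z => phi hp c d alpha z.1 (comb z.2)).
  apply: compact_has_minimum; first by exists (x0, w0).
    exact/compact_setX/std_simplex_compact.
  move=> [x w] [/= Xx sw].
  apply: (@phi_continuous_at _ fst (comb \o snd)) => //.
  - move=> k; apply: (@continuous_comp _ _ _ fst (fun y : 'cV[R]_n => y k 0)).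
      exact: cvg_fst.
    exact: coord_continuous.
  - move=> j; under [Z in {for _, continuous Z}]eq_fun do rewrite /= combE.
    apply: (@continuous_comp _ _ _ snd (fun w : 'cV[R]_pbar.+1 =>
        \sum_i v i j 0 * w i 0)).
      exact: cvg_snd.
    exact: comb_continuous.
  - by move=> j /=; rewrite combE; exact: comb_gt0.
exists (comb w) => [|_ [u su <-]]; first by exists w.
apply: le_minval => // y Xy.
apply: (@le_trans _ _ (phi hp c d alpha x (comb w))).
  by apply: psi_le_phi => // j; rewrite combE; exact: comb_gt0.
exact: (xwmin (y, u)).
Qed.

Lemma LB_objective_has_minimum :
  has_minimum (std_simplex R pbar) (LB_objective hp X c d alpha v).
Proof.
apply: compact_has_minimum;
  [exact: std_simplex_neq0|exact: std_simplex_compact|move=> w sw].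
apply: continuousB; apply: continuous_sum_at => j _.
  by apply: continuousM; [exact: cst_continuous|exact: coord_continuous].
apply: continuousM; first exact: cst_continuous.
apply: (@continuous_comp _ _ _
  (fun w : 'cV[R]_pbar.+1 => \sum_i v i j 0 * w i 0) (@ln R)).
  exact: comb_continuous.
exact/continuous_ln/comb_gt0.
Qed.

Lemma LB_objective_convex :
  convex_function (std_simplex R pbar) (LB_objective hp X c d alpha v).
Proof.
move=> l x y; rewrite !inE => sx sy.
rewrite convRE /LB_objective !mulrBr addrACA -opprD; apply: lerB.
  rewrite !mulr_sumr -big_split/=; apply: ler_sum => i _.
  rewrite !mxE; set a := _ + _.
  by rewrite mulrDr; apply: lerD; rewrite mulrCA.
rewrite !mulr_sumr -big_split/=; apply: ler_sum => j _.
have := concave_ln l (comb_gt0 x j sx) (comb_gt0 y j sy).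
have -> : \sum_i v i j 0 * (conv l x y) i 0 =
    conv l (\sum_i v i j 0 * x i 0 : R^o) (\sum_i v i j 0 * y i 0).
  rewrite convRE !mulr_sumr -big_split/=; apply: eq_bigr => i _.
  by rewrite !mxE mulrDr; congr (_ + _); rewrite mulrCA.
rewrite convRE => lnc.
rewrite ![_%:inum * _]mulrCA ![unstable.onem _ * _]mulrCA.
by rewrite -mulrDr ler_wpM2l.
Qed.

Lemma LB_objective_le_phi x w : X x -> std_simplex R pbar w ->
  LB_objective hp X c d alpha v w <= phi hp c d alpha x (comb w).
Proof.
move=> Xx sw; have [w1 w0] := sw.
pose q (t : 'cV[R]_pbar) :=
  \sum_(j < p | (pbar <= j)%N) alpha j * ln (affine_form c d j x) +
  \sum_(j < pbar) alpha (widen_ord hp j) *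
    (t j 0 * affine_form c d (widen_ord hp j) x - 1).
have phiE (t : 'cV[R]_pbar) : phi hp c d alpha x t +
    \sum_(j < pbar) alpha (widen_ord hp j) * ln (t j 0) = q t.
  rewrite /phi -addrA -big_split/=; congr (_ + _); apply: eq_bigr => j _.
  by ring.
have qE : \sum_i q (v i) * w i 0 = q (comb w).
  under eq_bigr do rewrite mulrDl.
  rewrite big_split/= -mulr_sumr w1 mulr1; congr (_ + _).
  under eq_bigr do rewrite mulr_suml.
  rewrite exchange_big/=; apply: eq_bigr => j _.
  rewrite combE mulr_suml -[in RHS]w1 -sumrB mulr_sumr.
  by apply: eq_bigr => i _; ring.
rewrite /LB_objective lerBlDr.
have -> : phi hp c d alpha x (comb w) + \sum_(j < pbar)
    alpha (widen_ord hp j) * ln (\sum_i v i j 0 * w i 0) = q (comb w).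
  by rewrite -phiE; congr (_ + _); apply: eq_bigr => j _; rewrite combE.
rewrite -qE; apply: ler_sum => i _; apply: ler_wpM2r => //.
rewrite -phiE lerD2r; apply: psi_le_phi => //; apply: v_gt0.
exact: simplex_vertex.
Qed.

Lemma LB_le_psi t : simplex v t ->
  LB hp X c d alpha v <= psi hp X c d alpha t.
Proof.
move=> [w sw <-]; apply: le_minval => // x Xx.
apply: le_trans (LB_objective_le_phi x w Xx sw).
by apply: minval_le => //; exact: LB_objective_has_minimum.
Qed.

End Simplex.
End LowerBound.

Theorem theorem3p1 (R : realType) (m n p pbar : nat)
    (p_ge2 : (2 <= p)%N) (pbar_ge1 : (1 <= pbar)%N) (hp : (pbar <= p)%N)
    (A : 'M[R]_(m, n)) (b : 'cV[R]_m)
    (c : 'I_p -> 'cV[R]_n) (d alpha : 'I_p -> R)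
    (X_nonempty : polyhedron A b !=set0)
    (X_bounded : bounded_set (polyhedron A b))
    (X_full_dim : full_dimensional (polyhedron A b))
    (alpha_pos : forall j : 'I_p, (j < pbar)%N -> 0 < alpha j)
    (alpha_neg : forall j : 'I_p, (pbar <= j)%N -> alpha j < 0)
    (form_pos : forall j : 'I_p,
      0 < minval (polyhedron A b) (affine_form c d j))
    (v : 'I_pbar.+1 -> 'cV[R]_pbar)
    (v_simplex : simplex v = simplex0 hp (polyhedron A b) c d \/
      affinely_independent v /\
      simplex v `<=` simplex0 hp (polyhedron A b) c d) :
  let X := polyhedron A b in
  [/\ [/\ forall t, simplex0 hp X c d t ->
            has_minimum X (fun x => phi hp c d alpha x t),
          has_minimum (std_simplex R pbar) (LB_objective hp X c d alpha v)
        & has_minimum (simplex v) (psi hp X c d alpha)],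
      convex_program (std_simplex R pbar) (LB_objective hp X c d alpha v)
    & LB hp X c d alpha v <= minval (simplex v) (psi hp X c d alpha)].
Proof.
move=> X.
have cX : compact X by exact: polyhedron_compact.
have S_sub : simplex v `<=` simplex0 hp X c d by case: v_simplex => [->|[]].
have S0_gt0 t : simplex0 hp X c d t -> forall j, 0 < t j 0.
  exact: simplex0_gt0.
have S_gt0 t : simplex v t -> forall j, 0 < t j 0 by move=> /S_sub /S0_gt0.
split; [split|split|].
- by move=> t /S0_gt0; exact: phi_has_minimum.
- exact: LB_objective_has_minimum.
- exact: psi_has_minimum.
- exact: std_simplex_convex.
- exact: LB_objective_convex.
- apply: le_minval => [|t St]; last exact: LB_le_psi.
  by exists (v ord0); exact: simplex_vertex.
Qed.
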